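(* Let $(Y,X,D)$ be random with $Y\in\mathbb R$, $X\in\mathbb R^p$, $D\in\{0,1\}$, and consider the linear regression model $Y=\alpha+\beta D+s(X)'\gamma+E$. Let $Z=(1,D,s(X)')'$, and suppose that $\mathbf E[\|Z\|^2]$ and $\mathbf E[\|ZE\|]$ are finite, $\mathbf E[ZZ']$ is positive definite, and $\mathbf E[ZE]=\mathbf 0$. Write $\mathcal X=\mathcal X^0\cup\mathcal X^1$ and $h(x)=f(x,0)-l_\theta^s(x,0)$ for $x\in\mathcal X$. Let $\Pi(G^1,G^0)$ be the set of all probability measures on $\mathcal X\times\mathcal X$ with first marginal $G^1$ and second marginal $G^0$, and define $$c^{\mathrm{MK/W}}=\inf_{\pi\in\Pi(G^1,G^0)}\int\|x_1-x_2\|\,\pi(\mathrm dx_1\mathrm dx_2),\qquad m^{\mathrm{MK/W}}=\sup_{x_1\ne x_2\in\mathcal X}\frac{|h(x_1)-h(x_2)|}{\|x_1-x_2\|}.$$ Then $$|\beta-\tau|\le m^{\mathrm{MK/W}}c^{\mathrm{MK/W}}.$$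
   Context: For $d\in\{0,1\}$, $G^d$ is the conditional distribution of $X$ given $D=d$, with (closed) support $\mathcal X^d\subseteq\mathbb R^p$. $F$ is the conditional distribution of $Y$ given $(X',D)'$, regarded as a given kernel defined for $(x,d)\in(\mathcal X^0\cup\mathcal X^1)\times\{0,1\}$, and $f(x,d)=\mathbf E[Y|X=x,D=d]$ is its mean. The parameter of interest is $$\tau=\mathbf E[Y|D=1]-\mathbf E[\mathbf E[Y|X,D=0]|D=1]=\mathbf E[Y|D=1]-\int f(x,0)\,G^1(\mathrm dx),$$ assumed to be well defined (i.e. $f(\cdot,0)$ is $G^1$-integrable). $s$ is a measurable map from $\mathbb R^p$ to a finite-dimensional Euclidean space, $\theta=(\alpha,\beta,\gamma')'$, and $l_\theta^s(x,d)=\alpha+\beta d+s(x)'\gamma$. $\|\cdot\|$ is the Euclidean norm. The quantities $m^{\mathrm{MK/W}},c^{\mathrm{MK/W}}$ take values in $[0,\infty]$, with the convention $0\cdot\infty=0$. *)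

(* Defs.v *)
From HB Require Import structures.
From mathcomp Require Import all_boot all_order all_algebra.
From mathcomp Require Import all_classical all_reals all_analysis.
From mathcomp Require Import measurable_realfun.
Set Implicit Arguments.
Unset Strict Implicit.
Unset Printing Implicit Defensive.
Import Order.TTheory GRing.Theory Num.Theory.
Import numFieldNormedType.Exports.
Local Open Scope classical_set_scope.
Local Open Scope ring_scope.

(* Borel sigma-algebra on real matrices, hence on the column vectors 'cV[R]_n
   that represent R^n. *)
HB.instance Definition _ (R : realType) (m n : nat) :=
  @isMeasurable.Build (sigma_display (@open 'M[R]_(m, n))) 'M[R]_(m, n)
    <<s @open 'M[R]_(m, n) >> (@sigma_algebra0 _ setT _) (@sigma_algebraC _ _)
    (@sigma_algebra_bigcup _ setT _).

(* The Euclidean norm: the norm `|v| of the library on matrices is the sup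
   norm, which induces the same topology. *)
Definition enorm (R : realType) (n : nat) (v : 'cV[R]_n) : R :=
  Num.sqrt (\sum_i v i 0 ^+ 2).

Definition posdefmx (R : realType) (n : nat) (M : 'M[R]_n) : Prop :=
  forall v : 'cV[R]_n, v != 0 -> 0 < (v^T *m M *m v) 0 0.

(* P (. | A), that is B |-> P (B `&` A) / P A.  If P A = 0 this is P by
   convention. *)
Definition cond_prob (d : measure_display) (T : measurableType d)
    (R : realType) (P : probability T R) (A : set T) (mA : measurable A) :
    probability T R :=
  mnormalize (mrestr P mA) P.

Section setup.
Context (dO : measure_display) (Omega : measurableType dO) (R : realType).
Context (P : probability Omega R) (p q : nat).
Implicit Types (X : {RV P >-> 'cV[R]_p}) (D : {RV P >-> bool})
  (Y : {RV P >-> R}) (s : 'cV[R]_p -> 'cV[R]_q) (S : set 'cV[R]_p)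
  (F : 'cV[R]_p * bool -> probability R R).

Definition cond_on D (d : bool) : probability Omega R :=
  cond_prob P (measurable_funPTI D (I : measurable [set d])).

(* G^d *)
Definition cond_law X D (d : bool) : probability 'cV[R]_p R :=
  distribution (cond_on D d) X.

Definition supp (G : probability 'cV[R]_p R) : set 'cV[R]_p :=
  [set x | forall U : set 'cV[R]_p, open U -> U x -> (0 < G U)%E].

(* The set X^0 `|` X^1. *)
Definition covariates X D : set 'cV[R]_p :=
  supp (cond_law X D false) `|` supp (cond_law X D true).

(* F is a probability kernel on S * {0,1} and a version of the conditional
   distribution of Y given (X, D).  Values of F outside S * {0,1} are
   irrelevant; they are not constrained here and not used below. *)
Definition cond_kernel X D Y S F : Prop :=
  (forall B, measurable B ->
     measurable_fun (S `*` [set: bool]) (fun z => F z B)) /\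
  (forall (A : set ('cV[R]_p * bool)) (B : set R),
     measurable A -> A `<=` S `*` [set: bool] -> measurable B ->
     P ([set w | A (X w, D w)] `&` Y @^-1` B) =
     (\int[P]_(w in [set w | A (X w, D w)]) F (X w, D w) B)%E).

(* f(x,d), as an extended real number: if the distribution F (x, d) has no
   finite mean, the value is +oo or -oo. *)
Definition cond_mean F (x : 'cV[R]_p) (d : bool) : \bar R :=
  (\int[F (x, d)]_y y%:E)%E.

Definition tau X D Y F : \bar R :=
  ('E_(cond_on D true)[Y] -
   \int[cond_law X D true]_(x in covariates X D) cond_mean F x false)%E.

Definition linpred s (alpha beta : R) (gamma : 'cV[R]_q)
    (x : 'cV[R]_p) (d : bool) : R :=
  alpha + beta * d%:R + ((s x)^T *m gamma) 0 0.

Definition residual X D Y s alpha beta gamma (w : Omega) : R :=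
  Y w - linpred s alpha beta gamma (X w) (D w).

Definition regressor X D s (w : Omega) : 'cV[R]_(1 + 1 + q) :=
  col_mx (col_mx 1%:M (D w)%:R%:M) (s (X w)).

Definition second_moment X D s : 'M[R]_(1 + 1 + q) :=
  \matrix_(i, j)
    fine ('E_P[fun w => (regressor X D s w *m (regressor X D s w)^T) i j]).

Definition hfun F s alpha beta gamma (x : 'cV[R]_p) : \bar R :=
  (cond_mean F x false - (linpred s alpha beta gamma x false)%:E)%E.

(* The supremum is taken in [0, +oo], so that it is 0 if S is a singleton.
   If h is infinite at x1 or x2, then `|h x1 - h x2| = +oo in the library,
   also when h x1 = h x2. *)
Definition mMKW S (h : 'cV[R]_p -> \bar R) : \bar R :=
  maxe 0%E (ereal_sup [set r | exists x1 x2, [/\ S x1, S x2, x1 <> x2 &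
    r = (`|h x1 - h x2| * (enorm (x1 - x2))^-1%:E)%E]]).

Definition couplings S (G1 G0 : probability 'cV[R]_p R) :
    set (probability ('cV[R]_p * 'cV[R]_p)%type R) :=
  [set pi | [/\ pi (S `*` S) = 1%E,
    forall A, measurable A -> pi (fst @^-1` A) = G1 A &
    forall A, measurable A -> pi (snd @^-1` A) = G0 A]].

Definition cMKW S (G1 G0 : probability 'cV[R]_p R) : \bar R :=
  ereal_inf [set (\int[pi]_(z in S `*` S) (enorm (z.1 - z.2))%:E)%E
            | pi in couplings S G1 G0].

End setup.

(* Main.v *)
(* The moment conditions with the regressors 1 and D say that E has mean zero
   given D = 0 and given D = 1 (both events have positive probability because
   E[ZZ'] is positive definite).  Disintegrating Y over (X, D) therefore gives
   \int h dG^0 = 0 and beta - tau = \int h dG^1, and the difference of these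
   integrals is the integral of h(x1) - h(x2) against any coupling of G^1 and
   G^0, hence at most m c.  The delicate case is m = +oo and c = 0, where
   0 * +oo = 0: it requires that c = 0 forces G^1 = G^0. *)
Require Import Defs.
From HB Require Import structures.
From mathcomp Require Import all_boot all_order all_algebra.
From mathcomp Require Import all_classical all_reals all_analysis.
From mathcomp Require Import measurable_realfun giry ring.
Import Order.TTheory GRing.Theory Num.Theory.
Import numFieldNormedType.Exports.
Local Open Scope classical_set_scope.
Local Open Scope ring_scope.

Set Implicit Arguments.
Unset Strict Implicit.
Unset Printing Implicit Defensive.

(** * Integrals against conditional and disintegrated laws *)

(** That c = 0 forces equal laws is shown without an optimal coupling. Couplings of cost below e *
    r, through Markov's inequality, compare the mass of the points of an open set at distance at
    least e from its complement under one law with the mass of the whole open set under the other; r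
    and then e tend to 0. The rest of the difficulty is in extended values. [X] need not have a
    first moment, so c may be +oo, and m = 0 then needs an argument of its own. The function h may
    be infinite at some points, and its integrability under [G^0] has to be extracted from that of
    [Y]. Since [F] is prescribed only over the two supports, disintegration takes place on events
    where [X] lies in them, which loses nothing because the supports carry full mass. *)

Lemma integral_mrestr (d : measure_display) (T : measurableType d)
    (R : realType) (mu : {measure set T -> \bar R}) (A B : set T)
    (mA : measurable A) (f : T -> \bar R) :
  measurable B -> measurable_fun B f ->
  (\int[mrestr mu mA]_(x in B) f x = \int[mu]_(x in A `&` B) f x)%E.
Proof.
move=> mB mf.
have mAB : measurable (A `&` B) by exact: measurableI.
have mBA : measurable (B `\` A) by exact: measurableD.
have -> : (\int[mrestr mu mA]_(x in B) f x =
  \int[mrestr mu mA]_(x in (A `&` B) `|` (B `\` A)) f x)%E.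
  by congr (integral _ _ _); rewrite setIC setUIDK.
rewrite integral_setU//; last 2 first.
- by rewrite setIC setUIDK.
- by apply/disj_setPS => x [[Ax _] [_]].
rewrite [X in (_ + X)%E]null_set_integral ?adde0//.
- apply: eq_measure_integral => C mC CAB.
  by rewrite /= /mrestr setIidl// => x /CAB[].
- by apply: measurable_funS mf => // x [].
- by rewrite /= /mrestr setDE -setIA setICl setI0 measure0.
Qed.

(* No hypothesis x +? - y: the junk value +oo - +oo = -oo is stable under
   multiplication by k > 0. *)
Lemma mule_gt0_subr (R : realType) (k : R) (x y : \bar R) : 0 < k ->
  (k%:E * (x - y) = k%:E * x - k%:E * y)%E.
Proof.
move=> k0; case: x y => [x| |] [y| |] /=;
  rewrite -?EFinB -?EFinM ?mulrBr// ?gt0_muley ?gt0_muleNy ?lte_fin//.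
Qed.

(** The identity holds for the positive and the negative part; [mule_gt0_subr] recombines them even
    when both integrals are infinite. *)
Lemma integral_cond_prob (d : measure_display) (T : measurableType d)
    (R : realType) (P : probability T R) (A B : set T) (mA : measurable A)
    (f : T -> \bar R) :
  (0 < P A)%E -> measurable B -> measurable_fun B f ->
  (\int[cond_prob P mA]_(x in B) f x =
   (fine (P A))^-1%:E * \int[P]_(x in A `&` B) f x)%E.
Proof.
move=> PA0 mB mf.
have PAfin : P A \is a fin_num by exact: fin_num_measure.
have k0 : 0 < (fine (P A))^-1.
  by rewrite invr_gt0 fine_gt0// PA0 ltey_eq PAfin.
pose k := NngNum (ltW k0).
have e g : (\int[cond_prob P mA]_(x in B) g x =
    \int[mscale k (mrestr P mA)]_(x in B) g x)%E.
  apply: eq_measure_integral => C mC _.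
  rewrite /= /cond_prob/= /mnormalize/= /mscale/= /mrestr setTI.
  (* [mnormalize] falls back to its default measure when the mass is 0 or +oo; both cases are
     excluded here and in the next step. *)
  rewrite gt_eqF//=.
  have -> : (P A == +oo)%E = false by apply: contraTF PAfin => /eqP ->.
  by rewrite muleC.
rewrite e -integral_mrestr// integralE [in RHS]integralE.
rewrite !ge0_integral_mscale//=; last 2 first.
- exact: measurable_funeneg.
- exact: measurable_funepos.
by rewrite [RHS]mule_gt0_subr.
Qed.

Lemma integral_pushforward_measurable (d1 d2 : measure_display)
    (T1 : measurableType d1) (T2 : measurableType d2) (R : realType)
    (mu : {measure set T1 -> \bar R}) (X : T1 -> T2) (S : set T2)
    (f : T2 -> \bar R) :
  measurable_fun [set: T1] X -> measurable S -> measurable_fun S f ->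
  (\int[pushforward mu X]_(x in S) f x =
   \int[mu]_(w in X @^-1` S) f (X w))%E.
Proof.
move=> mX mS mf.
rewrite (@integralE _ _ _ (pushforward mu X)) (@integralE _ _ _ mu).
congr (_ - _)%E.
- rewrite ge0_integral_pushforward//; last exact: measurable_funepos.
  by apply: eq_integral => w _; rewrite -funepos_comp.
- rewrite ge0_integral_pushforward//; last exact: measurable_funeneg.
  by apply: eq_integral => w _; rewrite -funeneg_comp.
Qed.

Lemma measurable_preimage (d1 d2 : measure_display)
    (T1 : measurableType d1) (T2 : measurableType d2) (X : T1 -> T2)
    (S : set T2) :
  measurable_fun [set: T1] X -> measurable S -> measurable (X @^-1` S).
Proof. by move=> mX mS; rewrite -[X @^-1` S]setTI; exact: mX. Qed.

Lemma measurable_fun_preimage_comp (d1 d2 d3 : measure_display)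
    (T1 : measurableType d1) (T2 : measurableType d2) (T3 : measurableType d3)
    (X : T1 -> T2) (S : set T2) (f : T2 -> T3) :
  measurable_fun [set: T1] X -> measurable S -> measurable_fun S f ->
  measurable_fun (X @^-1` S) (f \o X).
Proof.
move=> mX mS mf; apply: (measurable_comp mS) => //.
- by move=> _ [x /= Sx <-].
- exact: measurable_funTS.
Qed.

Lemma integral_cond_law (dO : measure_display) (Omega : measurableType dO)
    (R : realType) (P : probability Omega R) (p : nat)
    (X : {RV P >-> 'cV[R]_p}) (D : {RV P >-> bool}) (b : bool)
    (S : set 'cV[R]_p) (f : 'cV[R]_p -> \bar R) :
  (0 < P (D @^-1` [set b]))%E -> measurable S -> measurable_fun S f ->
  (\int[cond_law X D b]_(x in S) f x =
   (fine (P (D @^-1` [set b])))^-1%:E *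
   \int[P]_(w in D @^-1` [set b] `&` X @^-1` S) f (X w))%E.
Proof.
move=> Pb mS mf.
rewrite /cond_law [LHS]integral_pushforward_measurable//.
rewrite /cond_on integral_cond_prob//.
- exact: measurable_preimage.
- exact: measurable_fun_preimage_comp.
Qed.

(** The kernel is a measurable map into the space of measures, and its bind with [P] is the law of
    [Y] restricted to [A]. Measurability of the inner integral and the iterated integral formula are
    then properties of the Giry monad. *)
Lemma integral_disintegration (dO dY : measure_display)
    (Omega : measurableType dO) (T : measurableType dY) (R : realType)
    (P : probability Omega R) (A : set Omega) (Y : Omega -> T)
    (k : Omega -> probability T R) (g : T -> \bar R) :
  measurable A -> measurable_fun [set: Omega] Y ->
  (forall B, measurable B -> measurable_fun A (fun w => k w B)) ->
  (forall B, measurable B -> P (A `&` Y @^-1` B) =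
     \int[P]_(w in A) k w B)%E ->
  measurable_fun [set: T] g -> (forall y, 0 <= g y)%E ->
  measurable_fun A (fun w => \int[k w]_y g y)%E /\
  (\int[P]_(w in A) g (Y w) = \int[P]_(w in A) \int[k w]_y g y)%E.
Proof.
move=> mA mY mk Pk mg g0.
(* Extension by the zero measure turns integrals over [A] into integrals over the whole space. *)
pose k' (w : Omega) : giry T R := if w \in A then k w : giry T R else mzero.
have k'E w B : k' w B = ((fun w => k w B) \_ A) w.
  by rewrite /k' patchE; case: ifPn.
have k'int w : (giry_int (k' w) g = ((fun w => \int[k w]_y g y) \_ A) w)%E.
  rewrite /k' /giry_int patchE; case: ifPn => // _.
  exact: integral_measure_zero.
have mk' : measurable_fun [set: Omega] k'.
  apply: measurable_giry_codensity => // B mB.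
  rewrite (_ : k' ^~ B = (fun w => k w B) \_ A); last first.
    by apply/funext => w; rewrite k'E.
  by apply/(measurable_restrictT _ mA)/mk.
split.
  apply/(measurable_restrictT _ mA).
  rewrite (_ : _ \_ _ = (giry_int ^~ g) \o k'); last first.
    by apply/funext => w; rewrite /= k'int.
  by apply: measurableT_comp => //; exact: measurable_giry_int.
have := giry_int_bind (P : giry Omega R) mk' mg g0.
rewrite [RHS](_ : _ = \int[P]_(w in A) \int[k w]_y g y)%E; last first.
  rewrite /giry_int [RHS]integral_mkcond; apply: eq_integral => w _.
  by rewrite -/(giry_int _ _) k'int.
move=> <-.
transitivity (\int[pushforward (mrestr P mA) Y]_y g y)%E.
  rewrite integral_pushforward_measurable//.
  rewrite integral_mrestr ?preimage_setT ?setIT//.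
  exact: measurableT_comp.
apply: eq_measure_integral => B mB _.
rewrite [LHS](_ : _ = P (A `&` Y @^-1` B)); last by rewrite setIC.
rewrite Pk// integral_mkcond.
(* By definition the bind gives [B] the integral of the evaluation at [B] against the image of [P]
   under [k']. *)
have := giry_int_map mk' P (measurable_giry_ev mB) (fun m => measure_ge0 m B).
move=> bindE; apply: (etrans _ (esym bindE)).
by apply: eq_integral => w _; rewrite /= /giry_ev k'E.
Qed.

(** The nonnegative case applies to both parts of [g]. Integrability of [g \o Y] makes both
    integrals finite, so they can be subtracted, and it passes to the conditional means. *)
Lemma integral_disintegration_integrable (dO dY : measure_display)
    (Omega : measurableType dO) (T : measurableType dY) (R : realType)
    (P : probability Omega R) (A : set Omega) (Y : Omega -> T)
    (k : Omega -> probability T R) (g : T -> \bar R) :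
  measurable A -> measurable_fun [set: Omega] Y ->
  (forall B, measurable B -> measurable_fun A (fun w => k w B)) ->
  (forall B, measurable B -> P (A `&` Y @^-1` B) =
     \int[P]_(w in A) k w B)%E ->
  measurable_fun [set: T] g -> P.-integrable A (g \o Y) ->
  P.-integrable A (fun w => \int[k w]_y g y)%E /\
  (\int[P]_(w in A) g (Y w) = \int[P]_(w in A) \int[k w]_y g y)%E.
Proof.
move=> mA mY mk Pk mg gY.
have [mp ep] := integral_disintegration mA mY mk Pk (measurable_funepos mg)
  (funepos_ge0 _).
have [mn en] := integral_disintegration mA mY mk Pk (measurable_funeneg mg)
  (funeneg_ge0 _).
have ip := integrable_funepos mA gY.
have iN := integrable_funeneg mA gY.
have ipk : P.-integrable A (fun w => \int[k w]_y g^\+ y)%E.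
  apply/integrableP; split=> //.
  under eq_integral do rewrite gee0_abs ?integral_ge0//.
  by rewrite -ep; move: ip; rewrite funepos_comp => /(integrable_lty mA).
have ink : P.-integrable A (fun w => \int[k w]_y g^\- y)%E.
  apply/integrableP; split=> //.
  under eq_integral do rewrite gee0_abs ?integral_ge0//.
  by rewrite -en; move: iN; rewrite funeneg_comp => /(integrable_lty mA).
have kE : (fun w => \int[k w]_y g y)%E =
    ((fun w => \int[k w]_y g^\+ y) \- (fun w => \int[k w]_y g^\- y))%E.
  by apply/funext => w; rewrite integralE.
split; first by rewrite kE; exact: integrableB.
rewrite kE integralB// -ep -en [LHS](@integralE _ _ _ P A (g \o Y)).
by rewrite funepos_comp funeneg_comp.
Qed.

(** * Borel sets and supports in R^n *)

Section matrix_borel.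
Context (R : realType).

Lemma open_measurable_mx m n (U : set 'M[R]_(m, n)) : open U -> measurable U.
Proof. exact: sub_sigma_algebra. Qed.

Lemma closed_measurable_mx m n (U : set 'M[R]_(m, n)) :
  closed U -> measurable U.
Proof.
move=> cU; rewrite -(setCK U); apply: measurableC.
by apply: open_measurable_mx; exact: closed_openC.
Qed.

Lemma measurable_coord m n (i : 'I_m) (j : 'I_n) :
  measurable_fun [set: 'M[R]_(m, n)] (fun x => x i j).
Proof.
apply: (measurability (@RGenOpens.G R)) => //.
  exact: RGenOpens.measurableE.
move=> _ [_ [x [y ->]] <-]; rewrite setTI.
apply: open_measurable_mx; move/continuousP: (@coord_continuous R m n i j).
by apply; exact: interval_open.
Qed.

Lemma measurable_enorm (d : measure_display) (T : measurableType d) n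
    (f : T -> 'cV[R]_n) :
  (forall i, measurable_fun [set: T] (fun x => f x i 0)) ->
  measurable_fun [set: T] (fun x => enorm (f x)).
Proof.
move=> mf.
have msqrt : measurable_fun [set: R] (@Num.sqrt R).
  by apply: continuous_measurable_fun; exact: sqrt_continuous.
apply: (measurableT_comp msqrt).
by apply: measurable_sum => i; exact: measurable_funX.
Qed.

Lemma enorm_ge0 n (x : 'cV[R]_n) : 0 <= enorm x.
Proof. exact: sqrtr_ge0. Qed.

Lemma coord_le_enorm n (x : 'cV[R]_n) i : `|x i 0| <= enorm x.
Proof.
rewrite /enorm -sqrtr_sqr ler_wsqrtr// (bigD1 i)//= lerDl.
by apply: sumr_ge0 => j _; exact: sqr_ge0.
Qed.

Lemma mx_norm_le_enorm n (x : 'cV[R]_n) : `|x| <= enorm x.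
Proof.
rewrite /Num.norm/= mx_normrE; apply: bigmax_le; first exact: enorm_ge0.
by move=> [i j] _ /=; rewrite (ord1 j); exact: coord_le_enorm.
Qed.

Lemma enorm_gt0 n (x : 'cV[R]_n) : x != 0 -> 0 < enorm x.
Proof.
by move=> x0; apply: lt_le_trans (mx_norm_le_enorm x); rewrite normr_gt0.
Qed.

Lemma closed_supp n (G : probability 'cV[R]_n R) : closed (supp G).
Proof.
rewrite -[supp G]setCK; apply: open_closedC; rewrite openE => x /existsNP[U].
move=> /not_implyP[oU /not_implyP[Ux GU]].
have : nbhs x U by exact: open_nbhs_nbhs.
by apply: filterS => y Uy /(_ U oU Uy).
Qed.

Lemma measurable_supp n (G : probability 'cV[R]_n R) : measurable (supp G).
Proof. exact: (closed_measurable_mx (@closed_supp n G)). Qed.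

(** Balls with rational centre and radius 1/(k+1) form a countable base; this is what makes the
    complement of a support a countable union of null sets. *)
Lemma rational_ball n (x : 'cV[R]_n) (e : R) : 0 < e ->
  exists (r : 'cV[rat]_n) (k : nat),
    ball (map_mx ratr r : 'cV[R]_n) k.+1%:R^-1 x /\
    ball (map_mx ratr r : 'cV[R]_n) k.+1%:R^-1 `<=` ball x e.
Proof.
move=> e0; have [k] := ltr_add_invr (divr_gt0 e0 (@ltr0Sn R 1)).
rewrite add0r => ke.
have /choice[q hq] i : exists q : rat, `|x i 0 - ratr q| < k.+1%:R^-1.
  have xik : x i 0 < x i 0 + k.+1%:R^-1 by rewrite ltrDl invr_gt0.
  have [q] := rat_in_itvoo xik.
  rewrite in_itv/= => /andP[q1 q2]; exists q.
  by rewrite distrC ger0_norm ?subr_ge0 ?ltW// ltrBlDl.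
have hb : ball (map_mx ratr (\col_i q i) : 'cV[R]_n) k.+1%:R^-1 x.
  split=> [|i j]; first by rewrite invr_gt0.
  by rewrite (ord1 j) !mxE -ball_normE /= distrC.
exists (\col_i q i), k; split=> // y hy.
rewrite (splitr e).
apply: (@ball_triangle _ _ (map_mx ratr (\col_i q i) : 'cV[R]_n)).
- by apply: ball_sym; apply: le_ball hb; exact: ltW.
- by apply: le_ball hy; exact: ltW.
Qed.

Lemma measure_suppC n (G : probability 'cV[R]_n R) : G (~` supp G) = 0%E.
Proof.
apply/negligibleP.
 apply: measurableC; exact: measurable_supp.
pose B (rk : 'cV[rat]_n * nat) : set 'cV[R]_n :=
  ball (map_mx ratr rk.1 : 'cV[R]_n) rk.2.+1%:R^-1.
pose F i : set 'cV[R]_n :=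
  if unpickle i is Some rk then if G (B rk) == 0%E then B rk else set0
  else set0.
apply: (@negligibleS _ _ _ _ (\bigcup_i F i)); last first.
  apply: negligible_bigcup => i; rewrite /F.
  case: unpickle => [rk|]; last exact: negligible_set0.
  case: eqP => [G0|_]; last exact: negligible_set0.
  apply/negligibleP => //; by apply: open_measurable_mx; exact: ball_open.
move=> x /existsNP[U] /not_implyP[oU /not_implyP[Ux GU]].
have /nbhs_ballP[e /= e0 eU] : nbhs x U by exact: open_nbhs_nbhs.
have [r [k [xr rx]]] := rational_ball x e0.
exists (pickle (r, k)) => //; rewrite /F pickleK.
have -> : G (B (r, k)) == 0%E; last by [].
rewrite eq_le measure_ge0 andbT; apply: (@le_trans _ _ (G U)).
- apply: le_measure; rewrite ?inE.
  + by apply: open_measurable_mx; exact: ball_open.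
  + exact: open_measurable_mx.
  + by move=> y /rx/eU.
- by rewrite leNgt; exact/negP.
Qed.

Lemma measure_supp n (G : probability 'cV[R]_n R) : G (supp G) = 1%E.
Proof.
have mS : measurable (supp G) by exact: measurable_supp.
have := probability_setC G mS.
rewrite measure_suppC => /esym/eqP.
by rewrite sube_eq ?add0e => [/eqP <-||].
Qed.

End matrix_borel.

(** * The Monge-Kantorovich bound *)

Section kantorovich.
Context (R : realType) (p : nat).
Implicit Types (G : probability 'cV[R]_p R) (S U : set 'cV[R]_p).

Definition erosion (e : R) U : set 'cV[R]_p := [set x | ball x e `<=` U].

Lemma measurable_erosion e U : measurable (erosion e U).
Proof.
apply: closed_measurable_mx; rewrite -openC.
rewrite (_ : ~` erosion e U = \bigcup_(y in ~` U) ball y e).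
  by apply: bigcup_open => y _; exact: ball_open.
apply/seteqP; split=> [x /existsNP[y /not_implyP[xy Uy]]|x [y Uy yx] xU].
  by exists y => //; exact: ball_sym.
by apply: Uy; apply: xU; exact: ball_sym.
Qed.

Lemma bigcup_erosion U : open U -> \bigcup_k erosion k.+1%:R^-1 U = U.
Proof.
move=> oU; apply/seteqP; split=> [x [k _]|x Ux].
  by apply; apply: ballxx; rewrite invr_gt0.
have /nbhs_ballP[e /= e0 eU] : nbhs x U by exact: open_nbhs_nbhs.
have [k] := ltr_add_invr e0; rewrite add0r => ke; exists k => //.
by apply: subset_trans eU; apply: le_ball; exact: ltW.
Qed.

Lemma nondecreasing_erosion U :
  nondecreasing_seq (fun k => erosion k.+1%:R^-1 U).
Proof.
move=> m n mn; apply/subsetPset => x; apply: subset_trans; apply: le_ball.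
by rewrite lef_pV2 ?posrE// ler_nat.
Qed.

Section two_maps.
Context (d : measure_display) (T : measurableType d) (pi : probability T R).
Context (f g : T -> 'cV[R]_p).
Context (mf : measurable_fun [set: T] f) (mg : measurable_fun [set: T] g).

Lemma measurable_enorm_sub :
  measurable_fun [set: T] (fun z => enorm (f z - g z)).
Proof.
apply: measurable_enorm => i; under eq_fun do rewrite !mxE.
apply: measurable_funB.
- exact: (measurableT_comp (measurable_coord i 0) mf).
- exact: (measurableT_comp (measurable_coord i 0) mg).
Qed.

(* Markov's inequality for the distance between f and g: if f z lies in the
   e-erosion of U and g z does not lie in U, then f z and g z are e-apart. *)
Lemma erosion_le_transport W U (e : R) :
  measurable W -> pi W = 1%E -> open U -> 0 < e ->
  (pi (f @^-1` erosion e U) <= pi (g @^-1` U) +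
     e^-1%:E * \int[pi]_(z in W) (enorm (f z - g z))%:E)%E.
Proof.
move=> mW W1 oU e0.
have mE : measurable_fun W (fun z => (enorm (f z - g z))%:E).
  by apply/measurable_EFinP/measurable_funTS; exact: measurable_enorm_sub.
pose B := W `&` [set z | (e%:E <= `|(enorm (f z - g z))%:E|)%E].
have mB : measurable B.
  rewrite /B (_ : [set z | _] = (fun z => `|(enorm (f z - g z))%:E|%E) @^-1`
    `[e%:E, +oo[%classic); last first.
    by apply/seteqP; split=> z /=; rewrite in_itv/= andbT.
  have mabs : measurable_fun W (fun z => `|(enorm (f z - g z))%:E|%E).
    exact: measurableT_comp.
  by apply: mabs => //; exact: emeasurable_itv.
have mU : measurable (g @^-1` U).
  by apply: measurable_preimage => //; exact: open_measurable_mx.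
have mI : measurable (f @^-1` erosion e U).
  by apply: measurable_preimage => //; exact: measurable_erosion.
have W0 : pi (~` W) = 0%E by rewrite probability_setC// W1 subee.
apply: (@le_trans _ _ (pi (g @^-1` U `|` B `|` ~` W))).
  apply: le_measure; rewrite ?inE//.
    by apply: measurableU; [exact: measurableU|exact: measurableC].
  move=> z fz; have [Wz|] := pselect (W z); last by right.
  left; have [fge|fge] := ltP (enorm (f z - g z)) e.
    left; apply: fz; rewrite -ball_normE /=.
    exact: le_lt_trans (mx_norm_le_enorm _) fge.
  by right; split => //=; rewrite lee_fin ger0_norm// enorm_ge0.
apply: (le_trans (measureU2 _ _ _)).
- exact: measurableU.
- exact: measurableC.
rewrite [X in (_ + X)%E](_ : _ = 0%E)//= adde0.
apply: (le_trans (measureU2 _ mU mB)); apply: leeD2l.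
rewrite lee_pdivlMl//.
apply: (@le_trans _ _ (\int[pi]_(z in W) `|(enorm (f z - g z))%:E|)%E).
  exact: (@le_integral_comp_abse _ _ _ pi W mW _ e id).
by under eq_integral do rewrite gee0_abs ?lee_fin ?enorm_ge0//.
Qed.

End two_maps.

Lemma enormB n (x y : 'cV[R]_n) : enorm (x - y) = enorm (y - x).
Proof. by congr Num.sqrt; apply: eq_bigr => i _; rewrite -opprB mxE sqrrN. Qed.

Lemma measure_open_le (mu nu : probability 'cV[R]_p R) U : open U ->
  (forall e, 0 < e -> (mu (erosion e U) <= nu U)%E) -> (mu U <= nu U)%E.
Proof.
move=> oU le_e; rewrite -[in leLHS](bigcup_erosion oU).
have mui : mu \o (fun k => erosion k.+1%:R^-1 U) @ \oo -->
    mu (\bigcup_k erosion k.+1%:R^-1 U).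
  apply: nondecreasing_cvg_mu.
  - by move=> k; exact: measurable_erosion.
  - by apply: bigcupT_measurable => k; exact: measurable_erosion.
  - exact: nondecreasing_erosion.
rewrite -(cvg_lim _ mui)//; apply: lime_le; first by apply: cvgP mui.
by apply: nearW => k; apply: le_e; rewrite invr_gt0.
Qed.

Lemma cMKW_ge0 S (G1 G0 : probability 'cV[R]_p R) : (0 <= cMKW S G1 G0)%E.
Proof.
by apply/ereal_infP => _ [pi _ <-]; apply: integral_ge0 => z _;
  rewrite lee_fin enorm_ge0.
Qed.

Lemma mMKW_ge0 S (h : 'cV[R]_p -> \bar R) : (0 <= mMKW S h)%E.
Proof. by rewrite /mMKW le_max lexx. Qed.

Lemma cMKW_eq0 S (G1 G0 : probability 'cV[R]_p R) : measurable S ->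
  cMKW S G1 G0 = 0%E -> forall A, measurable A -> G1 A = G0 A.
Proof.
move=> mS c0.
have smallc e : 0 < e -> exists2 pi, couplings S G1 G0 pi &
    (\int[pi]_(z in S `*` S) (enorm (z.1 - z.2))%:E < e%:E)%E.
  move=> e0; have : (cMKW S G1 G0 < e%:E)%E by rewrite c0 lte_fin.
  by move=> /ereal_inf_ltP[_ [pi Hpi <-] ?]; exists pi.
have mSS : measurable (S `*` S) by exact: measurableX.
have le10 U : open U -> (G1 U <= G0 U)%E.
  move=> oU; apply: measure_open_le => // e e0; apply/lee_addgt0Pr => r r0.
  have [pi [piS pi1 pi0] ltpi] := smallc _ (mulr_gt0 e0 r0).
  rewrite -pi1; last exact: measurable_erosion.
  rewrite -pi0; last exact: open_measurable_mx.
  have := erosion_le_transport (@measurable_fst _ _ _ _)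
    (@measurable_snd _ _ _ _) mSS piS oU e0.
  move=> /le_trans; apply; apply: leeD2l.
  by rewrite lee_pdivrMl// -EFinM; exact: ltW.
have le01 U : open U -> (G0 U <= G1 U)%E.
  move=> oU; apply: measure_open_le => // e e0; apply/lee_addgt0Pr => r r0.
  have [pi [piS pi1 pi0] ltpi] := smallc _ (mulr_gt0 e0 r0).
  rewrite -pi0; last exact: measurable_erosion.
  rewrite -pi1; last exact: open_measurable_mx.
  have := erosion_le_transport (@measurable_snd _ _ _ _)
    (@measurable_fst _ _ _ _) mSS piS oU e0.
  move=> /le_trans; apply; apply: leeD2l.
  under eq_integral do rewrite enormB.
  by rewrite lee_pdivrMl// -EFinM; exact: ltW.
apply: (measure_unique (@open 'cV[R]_p) (fun=> setT)) => //.
- exact: openI.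
- by move=> _; exact: openT.
- by rewrite bigcup_const.
- by move=> U oU; apply/eqP; rewrite eq_le le10// le01.
- by move=> _; exact: le_lt_trans (probability_le1 _ measurableT) (ltry _).
Qed.

(* One finite value of h suffices: an infinite value at another point of S
   would make mMKW infinite. *)
Lemma lipschitz_mMKW S (h : 'cV[R]_p -> \bar R) (m : R) :
  mMKW S h = m%:E -> (exists2 x, S x & h x \is a fin_num) ->
  forall x1 x2, S x1 -> S x2 ->
  (`|h x1 - h x2| <= m%:E * (enorm (x1 - x2))%:E)%E.
Proof.
move=> mE [x0 Sx0 hx0].
have lip x1 x2 : S x1 -> S x2 -> x1 != x2 ->
    (`|h x1 - h x2| <= m%:E * (enorm (x1 - x2))%:E)%E.
  move=> S1 S2 x12.
  have e0 : 0 < enorm (x1 - x2) by rewrite enorm_gt0// subr_eq0.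
  rewrite muleC -lee_pdivrMl// muleC -mE /mMKW le_max; apply/orP; right.
  by apply: ereal_sup_ubound; exists x1, x2; split => //; exact/eqP.
have hfin x : S x -> h x \is a fin_num.
  move=> Sx; have [->//|xx0] := eqVneq x x0.
  have := lip _ _ Sx Sx0 xx0.
  by move: hx0; case: (h x) => [r| |]; case: (h x0).
move=> x1 x2 S1 S2; have [<-|/lip] := eqVneq x1 x2; last exact.
rewrite subee ?hfin// abse0 mule_ge0 ?lee_fin ?enorm_ge0//.
by rewrite -lee_fin -mE mMKW_ge0.
Qed.

Lemma integral_marginal (d : measure_display) (T : measurableType d)
    (pi : probability T R) (f : T -> 'cV[R]_p) G S W
    (h : 'cV[R]_p -> \bar R) :
  measurable_fun [set: T] f ->
  (forall A, measurable A -> pi (f @^-1` A) = G A) ->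
  measurable S -> measurable W -> pi W = 1%E -> W `<=` f @^-1` S ->
  G.-integrable S h ->
  pi.-integrable W (h \o f) /\
  (\int[G]_(x in S) h x = \int[pi]_(z in W) h (f z))%E.
Proof.
move=> mf piG mS mW W1 WS /[dup] hint /integrableP[mh hoo].
have mfS : measurable (f @^-1` S) by exact: measurable_preimage.
have mhf : measurable_fun (f @^-1` S) (h \o f).
  exact: measurable_fun_preimage_comp.
have GE k : measurable_fun S k ->
    (\int[G]_(x in S) k x = \int[pi]_(z in f @^-1` S) k (f z))%E.
  move=> mk; rewrite -(integral_pushforward_measurable pi mf mS mk).
  by apply: eq_measure_integral => A mA _; exact/esym/piG.
have hfint : pi.-integrable (f @^-1` S) (h \o f).
  apply/integrableP; split => //.
  by rewrite -(GE (abse \o h))//; exact: measurableT_comp.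
split; first exact: integrableS hfint.
rewrite GE// (@negligible_integral _ _ _ _ _ (~` W))//.
- by rewrite setDE setCK setIidr.
- exact: measurableC.
- by apply: (etrans (probability_setC pi mW)); rewrite W1 subee.
Qed.

Lemma coupling_bound S (G1 G0 : probability 'cV[R]_p R) pi
    (h : 'cV[R]_p -> \bar R) (m : R) :
  measurable S -> couplings S G1 G0 pi ->
  G1.-integrable S h -> G0.-integrable S h -> 0 <= m ->
  (forall x1 x2, S x1 -> S x2 ->
    (`|h x1 - h x2| <= m%:E * (enorm (x1 - x2))%:E)%E) ->
  (`|\int[G1]_(x in S) h x - \int[G0]_(x in S) h x| <=
   m%:E * \int[pi]_(z in S `*` S) (enorm (z.1 - z.2))%:E)%E.
Proof.
move=> mS [piS pi1 pi0] h1 h0 m0 hm.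
have mSS : measurable (S `*` S) by exact: measurableX.
have [int1 ->] := integral_marginal (@measurable_fst _ _ _ _) pi1 mS mSS piS
  (fun z (zS : (S `*` S) z) => zS.1) h1.
have [int0 ->] := integral_marginal (@measurable_snd _ _ _ _) pi0 mS mSS piS
  (fun z (zS : (S `*` S) z) => zS.2) h0.
rewrite -(integralB mSS int1 int0)/=.
have /integrableP[mB _] := integrableB mSS int1 int0.
have mE : measurable_fun (S `*` S) (fun z => (enorm (z.1 - z.2))%:E).
  apply/measurable_EFinP/measurable_funTS.
  by apply: measurable_enorm_sub; [exact: measurable_fst|exact: measurable_snd].
apply: (le_trans (le_abse_integral _ mSS mB)).
rewrite -ge0_integralZl//; last first.
  by move=> z _; rewrite lee_fin enorm_ge0.
apply: ge0_le_integral => //.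
- exact: measurableT_comp.
- exact: measurable_funeM.
- by move=> [x1 x2] [/= S1 S2]; exact: hm.
Qed.

Lemma integrable_exists_fin_num S G (h : 'cV[R]_p -> \bar R) :
  measurable S -> G S = 1%E -> G.-integrable S h ->
  exists2 x, S x & h x \is a fin_num.
Proof.
move=> mS GS hint; apply: contrapT => nex.
have [N [mN N0 SN]] := integrable_ae mS hint.
have : (G S <= G N)%E.
  apply: le_measure; rewrite ?inE// => x Sx; apply: SN => /= hx.
  by apply: nex; exists x => //; exact: hx.
by rewrite GS N0 lee_fin ler10.
Qed.

Lemma kantorovich_bound S (G1 G0 : probability 'cV[R]_p R)
    (h : 'cV[R]_p -> \bar R) :
  measurable S -> G1 S = 1%E -> G0 S = 1%E ->
  G1.-integrable S h -> G0.-integrable S h ->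
  (`|\int[G1]_(x in S) h x - \int[G0]_(x in S) h x| <=
   mMKW S h * cMKW S G1 G0)%E.
Proof.
move=> mS GS1 GS0 h1 h0.
have fin0 := integrable_fin_num mS h0.
have [c0|c0] := eqVneq (cMKW S G1 G0) 0%E.
  rewrite c0 mule0 (@eq_measure_integral _ _ _ _ G0).
    by rewrite subee// abse0.
  by move=> A mA _; exact: cMKW_eq0 c0 _ mA.
case E : (mMKW S h) => [m| |].
- have m0 : 0 <= m by rewrite -lee_fin -E mMKW_ge0.
  have lip := lipschitz_mMKW E (integrable_exists_fin_num mS GS1 h1).
  move: m0; rewrite le_eqVlt => /predU1P[m0|m0].
    have [x0 Sx0 hx0] := integrable_exists_fin_num mS GS1 h1.
    have hcst x : S x -> h x = h x0.
      move=> Sx; have := lip _ _ Sx Sx0; rewrite -m0 mul0e.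
      move: hx0; case: (h x0) => // r _; case: (h x) => [t| |] //=.
      by rewrite lee_fin normr_le0 subr_eq0 => /eqP ->.
    have ih G : G S = 1%E -> (\int[G]_(x in S) h x = h x0)%E.
      move=> GS; rewrite (eq_integral (cst (h x0))).
        by rewrite integral_cst// [X in (_ * X)%E](_ : _ = 1%E) ?mule1.
      by move=> x /[!inE]; exact: hcst.
    by rewrite !ih// subee// abse0 -m0 mul0e.
  rewrite -lee_pdivrMl//; apply/ereal_infP => _ [pi Hpi <-].
  by rewrite lee_pdivrMl//; apply: coupling_bound => //; exact: ltW.
- by rewrite gt0_mulye ?leey// lt_neqAle eq_sym c0 cMKW_ge0.
- by have := mMKW_ge0 S h; rewrite E.
Qed.

End kantorovich.

(** * The regression model *)

Section conditional_law.
Context (dO : measure_display) (Omega : measurableType dO) (R : realType).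
Context (P : probability Omega R) (p : nat).
Context (X : {RV P >-> 'cV[R]_p}) (D : {RV P >-> bool}) (b : bool).
Context (S : set 'cV[R]_p).
Context (Pb : (0 < P (D @^-1` [set b]))%E) (mS : measurable S).

Let mX : measurable_fun [set: Omega] X. Proof. exact: measurable_funPT. Qed.

Lemma measurable_event : measurable (D @^-1` [set b]).
Proof. exact: measurable_funPTI. Qed.

Lemma integrable_cond_law (f : 'cV[R]_p -> \bar R) : measurable_fun S f ->
  (cond_law X D b).-integrable S f <->
  P.-integrable (D @^-1` [set b] `&` X @^-1` S) (f \o X).
Proof.
move=> mf.
have k0 : 0 < (fine (P (D @^-1` [set b])))^-1.
  rewrite invr_gt0 fine_gt0// Pb ltey_eq fin_num_measure//.
  exact: measurable_event.
have mXS : measurable (X @^-1` S) by exact: measurable_preimage.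
have mfX : measurable_fun (D @^-1` [set b] `&` X @^-1` S) (f \o X).
  apply: measurable_funS (measurable_fun_preimage_comp mX mS mf) => //.
have mabs : measurable_fun S (fun x => `|f x|%E) by exact: measurableT_comp.
have e := integral_cond_law X Pb mS mabs.
split=> /integrableP[_ foo]; apply/integrableP; split => //.
- move: foo; rewrite [X in (X < _)%E]e.
  case: (\int[P]_(w in _) _)%E => [r||]; rewrite ?ltry//.
  by rewrite gt0_muley ?lte_fin.
- rewrite [X in (X < _)%E]e lte_mul_pinfty// lee_fin; exact: ltW.
Qed.

Lemma null_outside_supp : supp (cond_law X D b) `<=` S ->
  P (D @^-1` [set b] `\` X @^-1` S) = 0%E.
Proof.
move=> supS; have mCS := measurableC mS.
have : cond_law X D b (~` S) = 0%E.
  apply/eqP; rewrite eq_le measure_ge0 andbT.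
  rewrite -(measure_suppC (cond_law X D b)).
  apply: le_measure; rewrite ?inE//.
    by apply: measurableC; exact: measurable_supp.
  exact: subsetC.
have := @integral_cond_law _ _ _ _ _ X D b _ (cst 1%E) Pb
  mCS (measurable_cst _).
rewrite !integral_cst//.
- rewrite !mul1e => -> /eqP; rewrite mule_eq0 => /orP[|/eqP//].
  rewrite eqe invr_eq0 fine_eq0 ?fin_num_measure//.
    by rewrite gt_eqF.
  exact: measurable_event.
- apply: measurableI; [exact: measurable_event|exact: measurable_preimage].
Qed.

Lemma integral_event_supp (f : Omega -> \bar R) :
  supp (cond_law X D b) `<=` S -> measurable_fun [set: Omega] f ->
  (\int[P]_(w in D @^-1` [set b] `&` X @^-1` S) f w =
   \int[P]_(w in D @^-1` [set b]) f w)%E.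
Proof.
move=> supS mf.
have mD := measurable_event.
have mXS : measurable (X @^-1` S) by exact: measurable_preimage.
rewrite -[in RHS](@setUIDK _ (D @^-1` [set b]) (X @^-1` S)).
rewrite integral_setU//.
- rewrite [X in (_ + X)%E]null_set_integral ?adde0//.
  + exact: measurableD.
  + exact: measurable_funTS.
  + exact: null_outside_supp.
- exact: measurableI.
- exact: measurableD.
- exact: measurable_funTS.
- by apply/disj_setPS => x [[_ ?] [_]].
Qed.

End conditional_law.

Section regression.
Context (R : realType) (dO : measure_display) (Omega : measurableType dO).
Context (P : probability Omega R) (p q : nat).
Context (Y : {RV P >-> R}) (X : {RV P >-> 'cV[R]_p}) (D : {RV P >-> bool}).
Context (s : {mfun 'cV[R]_p >-> 'cV[R]_q}).
Context (alpha beta : R) (gamma : 'cV[R]_q).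

Let mX : measurable_fun [set: Omega] X. Proof. exact: measurable_funPT. Qed.
Let mD : measurable_fun [set: Omega] D. Proof. exact: measurable_funPT. Qed.
Let mY : measurable_fun [set: Omega] Y. Proof. exact: measurable_funPT. Qed.
Let mEvent b : measurable (D @^-1` [set b]).
Proof. exact: measurable_event. Qed.

Local Notation Z := (regressor X D s).
Local Notation E := (residual X D Y s alpha beta gamma).
Local Notation L := (fun x => linpred s alpha beta gamma x false).

Definition const_idx : 'I_(1 + 1 + q) := lshift q (lshift 1 ord0).
Definition treat_idx : 'I_(1 + 1 + q) := lshift q (rshift 1 ord0).

Lemma regressor_const w : Z w const_idx 0 = 1.
Proof. by rewrite /regressor !col_mxEu mxE. Qed.

Lemma regressor_treat w : Z w treat_idx 0 = (D w)%:R.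
Proof. by rewrite /regressor col_mxEu col_mxEd mxE. Qed.

Lemma regressor_cov w j : Z w (rshift (1 + 1) j) 0 = s (X w) j 0.
Proof. by rewrite /regressor col_mxEd. Qed.

Lemma outer_entry n (v : 'cV[R]_n) i j : (v *m v^T) i j = v i 0 * v j 0.
Proof. by rewrite mxE big_ord1 [v^T _ _]mxE. Qed.

Lemma regressor_idxP (Q : 'I_(1 + 1 + q) -> Prop) :
  Q const_idx -> Q treat_idx -> (forall j, Q (rshift (1 + 1) j)) ->
  forall i, Q i.
Proof.
move=> Qc Qt Qs i; case: (split_ordP i) => j ->; last exact: Qs.
by case: (split_ordP j) => k ->; rewrite (ord1 k).
Qed.

Lemma measurable_treat : measurable_fun [set: Omega] (fun w => (D w)%:R : R).
Proof.
rewrite (_ : (fun _ => _) = (fun w => if D w then 1 else 0)); last first.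
  by apply/funext => w; case: (D w).
exact: measurable_fun_ifT.
Qed.

Lemma measurable_covariate j :
  measurable_fun [set: 'cV[R]_p] (fun x => s x j 0).
Proof. exact: (measurableT_comp (measurable_coord j 0)). Qed.

Lemma measurable_regressor i : measurable_fun [set: Omega] (fun w => Z w i 0).
Proof.
elim/regressor_idxP: i => [||j].
- by under eq_fun do rewrite regressor_const; exact: measurable_cst.
- by under eq_fun do rewrite regressor_treat; exact: measurable_treat.
- under eq_fun do rewrite regressor_cov.
  exact: (measurableT_comp (measurable_covariate j)).
Qed.

Lemma measurable_linpred0 : measurable_fun [set: 'cV[R]_p] L.
Proof.
apply: measurable_funD; first exact: measurable_cst.
under eq_fun do rewrite mxE; apply: measurable_sum => j.
under eq_fun do rewrite mxE.
by apply: measurable_funM => //; exact: measurable_covariate.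
Qed.

Lemma linpredE x b : linpred s alpha beta gamma x b = L x + beta * b%:R.
Proof. by rewrite /linpred mulr0 addr0 addrAC. Qed.

Lemma residualE w : E w = Y w - (L (X w) + beta * (D w)%:R).
Proof. by rewrite /residual linpredE. Qed.

Lemma measurable_residual : measurable_fun [set: Omega] E.
Proof.
rewrite (_ : E = fun w => Y w - (L (X w) + beta * (D w)%:R)); last first.
  by apply/funext => w; exact: residualE.
apply: measurable_funB => //.
apply: measurable_funD; first exact: (measurableT_comp measurable_linpred0).
by apply: measurable_funM => //; exact: measurable_treat.
Qed.

Lemma second_moment_treat :
  second_moment X D s treat_idx treat_idx = fine (P (D @^-1` [set true])).
Proof.
rewrite mxE unlock; congr fine.
apply: etrans; last first.
  apply: etrans (congr1 P (setIT (D @^-1` [set true]))).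
  exact: (integral_indic P measurableT (mEvent true)).
apply: eq_integral => w _; rewrite outer_entry regressor_treat indicE.
case: (boolP (D w)) => Dw.
- by rewrite mem_set//= mulr1.
- by rewrite memNset /= ?mulr0//; exact/negP.
Qed.

Lemma second_moment_const i :
  second_moment X D s const_idx i = second_moment X D s i const_idx.
Proof.
rewrite ![second_moment _ _ _ _ _]mxE; congr (fine ('E_P[_])).
by apply/funext => w; rewrite !outer_entry mulrC.
Qed.

Lemma second_moment_const_treat :
  second_moment X D s const_idx treat_idx = fine (P (D @^-1` [set true])).
Proof.
rewrite -second_moment_treat ![second_moment _ _ _ _ _]mxE.
congr (fine ('E_P[_])); apply/funext => w; rewrite !outer_entry.
rewrite regressor_const !regressor_treat mul1r.
by case: (D w); rewrite ?mulr1 ?mulr0.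
Qed.

Lemma second_moment_const_const :
  second_moment X D s const_idx const_idx = 1.
Proof.
rewrite mxE (_ : (fun w => _) = cst 1) ?expectation_cst//.
by apply/funext => w; rewrite outer_entry regressor_const mulr1.
Qed.

Lemma quad_form_delta (M : 'M[R]_(1 + 1 + q)) i j :
  ((delta_mx i ord0 : 'cV[R]_(1 + 1 + q))^T *m M *m
   (delta_mx j ord0 : 'cV[R]_(1 + 1 + q))) 0 0 = M i j.
Proof. by rewrite trmx_delta -rowE -colE !mxE. Qed.

Lemma quad_form_deltaB (M : 'M[R]_(1 + 1 + q)) i j
    (v : 'cV[R]_(1 + 1 + q) := delta_mx i 0 - delta_mx j 0) :
  (v^T *m M *m v) 0 0 = M i i - M j i - (M i j - M j j).
Proof.
have mxB (A B : 'M[R]_1) : (A - B) 0 0 = A 0 0 - B 0 0 by rewrite !mxE.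
rewrite /v [(_ - _)^T]linearB /= mulmxBl mulmxBr mulmxBl mulmxBl !mxB.
by rewrite !quad_form_delta.
Qed.

Lemma treat_prob_gt0 b : posdefmx (second_moment X D s) ->
  (0 < P (D @^-1` [set b]))%E.
Proof.
move=> pd.
have Pfin : P (D @^-1` [set true]) \is a fin_num by exact: fin_num_measure.
case: b.
- have := pd (delta_mx treat_idx 0).
  rewrite quad_form_delta second_moment_treat -lte_fin fineK//; apply.
  apply/eqP => /matrixP/(_ treat_idx 0); rewrite !mxE !eqxx => /eqP.
  by rewrite oner_eq0.
- have := pd (delta_mx const_idx 0 - delta_mx treat_idx 0).
  rewrite quad_form_deltaB.
  rewrite -second_moment_const second_moment_const_const.
  rewrite second_moment_const_treat second_moment_treat subrr subr0.
  rewrite (_ : D @^-1` [set false] = ~` (D @^-1` [set true])); last first.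
    by apply/seteqP; split => w /=; case: (D w).
  rewrite probability_setC// -lte_fin EFinB fineK//; apply.
  apply/eqP => /matrixP/(_ const_idx 0); rewrite !mxE !eqxx/= subr0 => /eqP.
  by rewrite oner_eq0.
Qed.

Let mL : measurable_fun [set: 'cV[R]_p] L.
Proof. exact: measurable_linpred0. Qed.
Let mE : measurable_fun [set: Omega] E. Proof. exact: measurable_residual. Qed.

Context (Z2 : ('E_P[fun w => (enorm (Z w) ^+ 2)%R] < +oo)%E).
Context (EZ1 : ('E_P[fun w => enorm (E w *: Z w)%R] < +oo)%E).
Context (EZ0 : (forall i, 'E_P[fun w => (Z w i ord0 * E w)%R] = 0)%E).

Lemma integrable_of_le (f g : Omega -> R) :
  measurable_fun [set: Omega] f -> measurable_fun [set: Omega] g ->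
  (forall w, `|f w| <= g w) -> (\int[P]_w (g w)%:E < +oo)%E ->
  P.-integrable [set: Omega] (EFin \o f).
Proof.
move=> mf mg fg goo; apply/integrableP; split; first exact/measurable_EFinP.
apply: le_lt_trans goo; apply: ge0_le_integral => //.
- by apply/measurable_EFinP; exact: measurableT_comp.
- exact/measurable_EFinP.
- by move=> w _; rewrite lee_fin.
Qed.

Lemma integrable_residual : P.-integrable [set: Omega] (EFin \o E).
Proof.
apply: (@integrable_of_le _ (fun w => enorm (E w *: Z w))) => //.
- apply: measurable_enorm => i; under eq_fun do rewrite mxE.
  by apply: measurable_funM => //; exact: measurable_regressor.
- move=> w; apply: le_trans (coord_le_enorm _ const_idx).
  by rewrite mxE regressor_const mulr1.
- by move: EZ1; rewrite unlock.
Qed.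

Lemma integrable_covariate j :
  P.-integrable [set: Omega] (fun w => (s (X w) j 0)%:E).
Proof.
have mn : measurable_fun [set: Omega] (fun w => enorm (Z w)).
  by apply: measurable_enorm; exact: measurable_regressor.
apply: (@integrable_of_le _ (fun w => 1 + enorm (Z w) ^+ 2)).
- exact: (measurableT_comp (measurable_covariate j)).
- by apply: measurable_funD => //; exact: measurable_funX.
- move=> w; rewrite -regressor_cov.
  apply: le_trans (coord_le_enorm _ _) _.
  have [n1|n1] := leP (enorm (Z w)) 1.
    by rewrite (le_trans n1)// lerDl sqr_ge0.
  rewrite (@le_trans _ _ (enorm (Z w) ^+ 2)) ?lerDr// expr2.
  by rewrite ler_peMl// ltW// (lt_trans ltr01).
- under eq_integral do rewrite EFinD.
  rewrite ge0_integralD//.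
  + rewrite lte_add_pinfty//; last by move: Z2; rewrite unlock.
    by rewrite integral_cst// mul1e (le_lt_trans (probability_le1 P _)) ?ltry.
  + by move=> w _; rewrite lee_fin sqr_ge0.
  + by apply/measurable_EFinP; exact: measurable_funX.
Qed.

Lemma integrable_linpred0 : P.-integrable [set: Omega] (fun w => (L (X w))%:E).
Proof.
rewrite (_ : (fun w => _) = (cst (alpha%:E) \+
    (fun w => \sum_(j < q) (gamma j 0)%:E * (s (X w) j 0)%:E))%E); last first.
  apply/funext => w; rewrite /linpred mulr0 addr0 EFinD mxE -sumEFin.
  congr (_ + _)%E.
  by apply: eq_bigr => j _; rewrite mxE mulrC EFinM.
apply: integrableD => //; first exact: finite_measure_integrable_cst.
apply: integrable_sum => // j _.
by apply: integrableZl => //; exact: integrable_covariate.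
Qed.

Lemma integrable_treat :
  P.-integrable [set: Omega] (fun w => (beta * (D w)%:R)%:E).
Proof.
apply: (@integrable_of_le _ (cst `|beta|)) => //.
- by apply: measurable_funM => //; exact: measurable_treat.
- by move=> w; case: (D w); rewrite ?mulr1 ?mulr0 ?normr0.
- apply: (@le_lt_trans _ _ (`|beta|%:E * P [set: Omega])%E).
    by rewrite -(integral_cst P measurableT).
  by rewrite lte_mul_pinfty// (le_lt_trans (probability_le1 P _)) ?ltry.
Qed.

Lemma outcomeE : EFin \o Y =
  ((fun w => (L (X w))%:E) \+ (fun w => (beta * (D w)%:R)%:E) \+ (EFin \o E))%E.
Proof.
apply/funext => w; rewrite /= -!EFinD; congr EFin.
by rewrite residualE subrKC.
Qed.

Lemma integrable_outcome : P.-integrable [set: Omega] (EFin \o Y).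
Proof.
rewrite outcomeE; apply: integrableD => //; last exact: integrable_residual.
apply: integrableD => //; first exact: integrable_linpred0.
exact: integrable_treat.
Qed.

Lemma integral_residual_treated :
  (\int[P]_(w in D @^-1` [set true]) (E w)%:E = 0)%E.
Proof.
rewrite integral_mkcond -(EZ0 treat_idx) unlock.
apply: eq_integral => w _; rewrite patchE regressor_treat.
case: (boolP (D w)) => Dw.
- by rewrite mem_set//= mul1r.
- by rewrite memNset ?mul0r//; exact/negP.
Qed.

Lemma integral_residual_control :
  (\int[P]_(w in D @^-1` [set false]) (E w)%:E = 0)%E.
Proof.
have := EZ0 const_idx; rewrite unlock.
under eq_integral do rewrite regressor_const mul1r.
have -> : [set: Omega] = D @^-1` [set true] `|` D @^-1` [set false].
  by apply/seteqP; split => w //= _; case: (D w); [left|right].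
rewrite integral_setU//; first by rewrite integral_residual_treated add0e.
- by apply/measurable_funTS/measurable_EFinP.
- by apply/disj_setPS => w [/= -> ].
Qed.

Context (F : 'cV[R]_p * bool -> probability R R).
Local Notation S := (covariates X D).
Local Notation h := (hfun F s alpha beta gamma).
Context (kerF : cond_kernel X D Y S F).
Context (intF : (cond_law X D true).-integrable S
  (fun x => cond_mean F x false)).
Context (pd : posdefmx (second_moment X D s)).

Let mS : measurable S.
Proof. by apply: measurableU; exact: measurable_supp. Qed.

Let supS b : supp (cond_law X D b) `<=` S.
Proof. by case: b => x; [right|left]. Qed.

Let Pb b : (0 < P (D @^-1` [set b]))%E.
Proof. exact: treat_prob_gt0. Qed.

Let mXS b : measurable (D @^-1` [set b] `&` X @^-1` S).
Proof. by apply: measurableI => //; exact: measurable_preimage. Qed.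

Let mh : measurable_fun S h.
Proof.
apply: emeasurable_funB; first exact: measurable_int intF.
exact/measurable_EFinP/measurable_funTS.
Qed.

Let integrable_event A (f : Omega -> \bar R) : measurable A ->
  P.-integrable [set: Omega] f -> P.-integrable A f.
Proof. by move=> mA; apply: integrableS => //; exact: measurableT. Qed.

Lemma cond_mean_control (A := D @^-1` [set false] `&` X @^-1` S) :
  P.-integrable A (fun w => cond_mean F (X w) false) /\
  (\int[P]_(w in A) cond_mean F (X w) false = \int[P]_(w in A) (Y w)%:E)%E.
Proof.
have [mF eF] := kerF.
have mXD : measurable_fun [set: Omega] (fun w => (X w, D w)).
  exact: measurable_fun_pair.
have AE : A = [set w | (S `*` [set false]) (X w, D w)].
  by apply/seteqP; split=> w [].
have kE w : A w -> cond_mean F (X w) false = (\int[F (X w, D w)]_y y%:E)%E.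
  by move=> [/= -> _].
have [] := @integral_disintegration_integrable _ _ _ _ _ P A Y
    (fun w => F (X w, D w)) EFin (mXS false) mY.
- move=> B mB.
  have mSb : measurable (S `*` [set: bool]) by exact: measurableX.
  apply: measurable_funS (measurable_fun_preimage_comp mXD mSb (mF B mB)).
    exact: measurable_preimage.
  by rewrite AE => w [].
- move=> B mB; rewrite AE; apply: eF => //; first exact: measurableX.
  by move=> [x b] [].
- exact/measurable_EFinP.
- exact: integrable_event (mXS false) integrable_outcome.
move=> ik ek; split.
  by apply: eq_integrable ik => [|w /[!inE] Aw]; [exact: mXS|rewrite kE].
by rewrite ek; apply: eq_integral => w /[!inE]; exact: kE.
Qed.

Lemma integrable_linpred_supp b :
  P.-integrable (D @^-1` [set b] `&` X @^-1` S) (fun w => (L (X w))%:E).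
Proof. exact: integrable_event (mXS b) integrable_linpred0. Qed.

Lemma hfun_control :
  (cond_law X D false).-integrable S h /\
  (\int[cond_law X D false]_(x in S) h x = 0)%E.
Proof.
have [fint fE] := cond_mean_control.
have iL := integrable_linpred_supp false.
split.
  apply/(integrable_cond_law X (Pb false) mS mh).
  exact: integrableB fint iL.
rewrite integral_cond_law// [X in (_ * X)%E](_ : _ = 0%E) ?mule0//.
rewrite (integralB _ fint iL)// fE -(integralB (mXS false) _ iL); last first.
  exact: integrable_event (mXS false) integrable_outcome.
rewrite -integral_residual_control.
rewrite -(integral_event_supp (X := X) (Pb false) mS)//.
- apply: eq_integral => w /[!inE] -[/= Dw _].
  by rewrite residualE Dw mulr0 addr0 EFinB.
- exact/measurable_EFinP.
Qed.

Lemma tauE :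
  (beta%:E - tau X D Y F = \int[cond_law X D true]_(x in S) h x)%E /\
  (cond_law X D true).-integrable S h.
Proof.
have iL : (cond_law X D true).-integrable S (fun x => (L x)%:E).
  apply/(integrable_cond_law X (Pb true) mS) => //.
  - exact/measurable_EFinP/measurable_funTS.
  - exact: integrable_linpred_supp.
split; last exact: integrableB intF iL.
have Pfin : P (D @^-1` [set true]) \is a fin_num by exact: fin_num_measure.
have EY : ('E_(cond_on D true)[Y] =
    beta%:E + \int[cond_law X D true]_(x in S) (L x)%:E)%E.
  rewrite unlock integral_cond_prob//; last exact/measurable_EFinP.
  rewrite setIT [X in (_ * X)%E](_ : _ =
      \int[P]_(w in D @^-1` [set true]) (L (X w))%:E +
      beta%:E * P (D @^-1` [set true]))%E; last first.
    have iLD : P.-integrable (D @^-1` [set true]) (fun w => (L (X w))%:E).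
      exact: integrable_event (mEvent true) integrable_linpred0.
    have iTD : P.-integrable (D @^-1` [set true])
        (fun w => (beta * (D w)%:R)%:E).
      exact: integrable_event (mEvent true) integrable_treat.
    have iED : P.-integrable (D @^-1` [set true]) (EFin \o E).
      exact: integrable_event (mEvent true) integrable_residual.
    have -> : (fun w => (Y w)%:E) = EFin \o Y by [].
    rewrite outcomeE (integralD _ _ iED)//; last exact: integrableD.
    rewrite integral_residual_treated adde0 integralD//; congr (_ + _)%E.
    rewrite -integral_cst//; apply: eq_integral => w /[!inE] /= ->.
    by rewrite mulr1.
  rewrite (integral_cond_law _ (Pb true) mS); last first.
    exact/measurable_EFinP/measurable_funTS.
  rewrite integral_event_supp//; last first.
    exact/measurable_EFinP/(measurableT_comp mL).
  have : (\int[P]_(w in D @^-1` [set true]) (L (X w))%:E)%E \is a fin_num.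
    apply: integrable_fin_num => //.
    exact: integrable_event (mEvent true) integrable_linpred0.
  have : 0 < fine (P (D @^-1` [set true])).
    by rewrite fine_gt0// Pb ltey_eq Pfin.
  rewrite -[in X in (_ * (_ + X))%E](fineK Pfin).
  move=> c0 /fineK <-; rewrite -?EFinM -?EFinD -?EFinM -?EFinD. congr EFin.
  by field; rewrite gt_eqF.
rewrite /tau EY [RHS](integralB mS intF iL).
have /fineK <- := integrable_fin_num mS intF.
have /fineK <- := integrable_fin_num mS iL.
rewrite -?EFinD -?EFinN -?EFinD; congr EFin; ring.
Qed.

End regression.

Unset Implicit Arguments.
Set Strict Implicit.
Set Printing Implicit Defensive.

Theorem corollary2 (R : realType) (dO : measure_display)
    (Omega : measurableType dO) (P : probability Omega R) (p q : nat)
    (Y : {RV P >-> R}) (X : {RV P >-> 'cV[R]_p}) (D : {RV P >-> bool})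
    (s : {mfun 'cV[R]_p >-> 'cV[R]_q})
    (alpha beta : R) (gamma : 'cV[R]_q)
    (F : 'cV[R]_p * bool -> probability R R)
    (Z := regressor X D s) (E := residual X D Y s alpha beta gamma)
    (S := covariates X D) (G := cond_law X D)
    (h := hfun F s alpha beta gamma) :
  cond_kernel X D Y S F ->
  (G true).-integrable S (fun x => cond_mean F x false) ->
  ('E_P[fun w => (enorm (Z w) ^+ 2)%R] < +oo)%E ->
  ('E_P[fun w => enorm (E w *: Z w)%R] < +oo)%E ->
  posdefmx (second_moment X D s) ->
  (forall i, 'E_P[fun w => (Z w i ord0 * E w)%R] = 0)%E ->
  (`|beta%:E - tau X D Y F| <= mMKW S h * cMKW S (G true) (G false))%E.
Proof.
move=> kerF intF Z2 EZ1 pd EZ0.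
have [-> h1] := tauE Z2 EZ1 EZ0 intF pd.
have [h0 h00] := hfun_control Z2 EZ1 EZ0 kerF intF pd.
have mS : measurable S by apply: measurableU; exact: measurable_supp.
have GS b : G b S = 1%E.
  apply/eqP; rewrite eq_le probability_le1//= -(measure_supp (G b)).
  apply: le_measure; rewrite ?inE//; first exact: measurable_supp.
  by case: b => x; [right|left].
have := kantorovich_bound mS (GS true) (GS false) h1 h0.
by rewrite h00 sube0.
Qed.
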